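(* Let $q$ be a prime power and let $\mathcal{P}_q$ be the Levi graph of the projective plane over the finite field $\mathbb{F}_q$. Then $\mathcal{P}_q$ is a finite simplicial graph with diameter $3$ and girth $6$. It has $(1,6)$--branching if $q=2$ and $(q,6)$--branching otherwise.
   Context: $\mathcal{P}_q$ is the bipartite graph whose vertices are the 1-dimensional (points) and 2-dimensional (lines) vector subspaces of $V=\mathbb{F}_q^3$, with an edge between a 1-dimensional subspace and a 2-dimensional subspace exactly when the former is contained in the latter. For a vertex $x$ of a graph, $\operatorname{Lk}(x)$ denotes the set of neighbors of $x$. A subgraph is induced if it contains every edge of the ambient graph joining two of its vertices. Definition ($(n,m)$--branching). For $n\ge 1$ and $m\ge 5$, a finite simplicial graph $\Gamma$ has $(n,m)$--branching if every vertex has valence at least $n+1$ and for every induced path $P$ of length 1 or 2 with endpoints $u$ and $v$ the following holds: for every set $\{u_1,\dots,u_n\}$ of distinct vertices in $\operatorname{Lk}(u)\setminus P$ there exist a set $\{v_1,\dots,v_n\}$ of distinct vertices in $\operatorname{Lk}(v)\setminus P$ and cycle subgraphs $H_1,\dots,H_n$ of $\Gamma$ such that for all $i\ne j$: (i) $5\le |H_i|\le m$, where $|H_i|$ is the length of the cycle; (ii) $H_i$ contains $\{u_i,v_i\}\cup P$; (iii) $H_i\cap H_j=P$; and (iv) $\bigcup_i H_i$ is an induced subgraph of $\Gamma$. *)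

(* Defs.v *)
From HB Require Import structures.
From mathcomp Require Import all_boot all_order all_algebra.

Set Implicit Arguments.
Unset Strict Implicit.
Unset Printing Implicit Defensive.

Section Graphs.
Variables (T : eqType) (e : rel T).

Definition finite_simplicial_graph : Prop :=
  [/\ exists s : seq T, forall x, x \in s, symmetric e & irreflexive e].

Definition dist_is (x y : T) (d : nat) : Prop :=
  (exists p : seq T, [/\ path e x p, last x p = y & size p = d]) /\
  (forall p : seq T, path e x p -> last x p = y -> d <= size p).

Definition diameter_is (d : nat) : Prop :=
  (forall x y, exists2 k, dist_is x y k & k <= d) /\
  (exists x y, dist_is x y d).

Definition is_cycle (c : seq T) : Prop := 3 <= size c /\ ucycle e c.

Definition girth_is (g : nat) : Prop :=
  (exists2 c, is_cycle c & size c = g) /\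
  (forall c, is_cycle c -> g <= size c).

Definition valence_ge (x : T) (k : nat) : Prop :=
  exists s : seq T, [/\ uniq s, all (e x) s & k <= size s].

(* [vert] and [edge] are unconstrained here; the edge predicate is symmetric and implies membership of both endpoints
   in all the subgraphs built below. *)
Record subgraph := Subgraph { vert : pred T; edge : rel T }.

Definition pair_rel (E : seq (T * T)) : rel T :=
  fun x y => ((x, y) \in E) || ((y, x) \in E).

(* [zip s (behead s)], resp. [zip c (rot 1 c)], lists the consecutive pairs of a
   sequence, resp. of a cyclic sequence. *)
Definition path_graph (s : seq T) : subgraph :=
  Subgraph (fun x => x \in s) (pair_rel (zip s (behead s))).

Definition cycle_graph (c : seq T) : subgraph :=
  Subgraph (fun x => x \in c) (pair_rel (zip c (rot 1 c))).

Definition sub_graph (H K : subgraph) : Prop :=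
  (forall x, vert H x -> vert K x) /\ (forall x y, edge H x y -> edge K x y).

Definition eq_graph (H K : subgraph) : Prop :=
  vert H =1 vert K /\ edge H =2 edge K.

Definition cap_graph (H K : subgraph) : subgraph :=
  Subgraph (fun x => vert H x && vert K x) (fun x y => edge H x y && edge K x y).

Definition bigcup_graph n (H : 'I_n -> subgraph) : subgraph :=
  Subgraph (fun x => [exists i, vert (H i) x])
           (fun x y => [exists i, edge (H i) x y]).

Definition induced (H : subgraph) : Prop :=
  forall x y, vert H x -> vert H y -> e x y -> edge H x y.

(* The path is [u :: p]: it starts at [u], and its length is [size p]. *)
Definition induced_path (u v : T) (p : seq T) : Prop :=
  [/\ path e u p, last u p = v, uniq (u :: p) & induced (path_graph (u :: p))].

Definition branching (n m : nat) : Prop :=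
  [/\ 1 <= n, 5 <= m, finite_simplicial_graph, forall x, valence_ge x n.+1 &
   forall (u v : T) (p : seq T),
     induced_path u v p -> (size p = 1 \/ size p = 2) ->
   forall us : 'I_n -> T,
     injective us -> (forall i, e u (us i) /\ us i \notin u :: p) ->
   exists vs : 'I_n -> T, exists H : 'I_n -> seq T,
     [/\ injective vs /\ (forall i, e v (vs i) /\ vs i \notin u :: p),
         forall i, is_cycle (H i) /\ 5 <= size (H i) <= m,
         forall i, [/\ us i \in H i, vs i \in H i &
                       sub_graph (path_graph (u :: p)) (cycle_graph (H i))],
         forall i j, i != j ->
           eq_graph (cap_graph (cycle_graph (H i)) (cycle_graph (H j)))
                    (path_graph (u :: p)) &
         induced (bigcup_graph (fun i => cycle_graph (H i)))]].

End Graphs.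

Definition levi_vertex (F : finFieldType) : eqType :=
  {U : {vspace 'rV[F]_3} | (\dim U == 1) || (\dim U == 2)}.

Definition incident (F : finFieldType) (U W : {vspace 'rV[F]_3}) : bool :=
  [&& \dim U == 1, \dim W == 2 & (U <= W)%VS].

Definition levi (F : finFieldType) : rel (levi_vertex F) :=
  fun x y => incident (val x) (val y) || incident (val y) (val x).

(* Main.v *)
Require Import Defs.
From mathcomp Require Import all_boot all_order all_algebra.

(* Two distinct vertices of the same kind have exactly one common neighbour; this gives
   diameter 3, girth at least 6, and makes every hexagon induced. So for branching it is
   enough to complete P to hexagons whose parts outside P have no edges between them.
   If P = u, w, v has length 2, close up each pair u_i, v_i by their common neighbour: any
   choice of distinct v_i works. If P is an edge, say u a point on the line v, take v as the
   line at infinity: the u_i are then parallel lines x = i, and one needs points (i, f i) on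
   them and distinct slopes m_i such that the line of slope m_i through (i, f i) misses all
   the other points (j, f j). For q > 2 the indicator function f of 0 admits such slopes.
   These families use all the neighbours of u and v outside P, so they can be read from
   either end of P, which also settles the case where u is a line and v a point. *)

Set Implicit Arguments.
Unset Strict Implicit.
Unset Printing Implicit Defensive.

Import GRing.Theory.

(** * Cycles glued along a common path *)

Section Glue.
Variables (T : eqType) (e : rel T).
Hypothesis eC : symmetric e.

Lemma path_graph_edge u p x y :
  path e u p -> edge (path_graph (u :: p)) x y ->
  [/\ x \in u :: p, y \in u :: p & e x y].
Proof.
rewrite /= /pair_rel => up.
suff H a b : (a, b) \in zip (u :: p) p -> [/\ a \in u :: p, b \in u :: p & e a b].
  by case/orP=> /H [] // *; split; rewrite // eC.
elim: p u up => [|w p IHp] u //= /andP[uw wp]; rewrite inE => /orP[/eqP[-> ->]|].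
  by rewrite !inE !eqxx ?orbT.
by move/(IHp _ wp)=> [aP bP ab]; split=> //; apply/orP; right.
Qed.

(** [zip] stops at the end of the shorter list, so the last entry of [u :: p] never occurs on the
    left. *)
Lemma zip_cons_belast (A : Type) (u : A) p : zip (u :: p) p = zip (belast u p) p.
Proof. by elim: p u => //= w p IHp u; rewrite IHp. Qed.

Lemma cycle_graphE (u : T) p :
  cycle_graph (u :: p) =
    Subgraph (fun x : T => x \in u :: p) (pair_rel (zip (u :: p) (rcons p u))).
Proof. by rewrite /cycle_graph rot1_cons. Qed.

Lemma cycle_graph_edge c x y : cycle e c -> edge (cycle_graph c) x y ->
  [/\ x \in c, y \in c & e x y].
Proof.
case: c => [//|u p]; rewrite [cycle _ _]/= cycle_graphE => up.
(* The cycle is read as the closed path [u :: rcons p u], so that [path_graph_edge] applies. *)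
have Ez : zip (u :: p) (rcons p u) = zip (u :: rcons p u) (rcons p u).
  by rewrite zip_cons_belast belast_rcons.
rewrite [edge _ _]/= Ez => xy; have [] := path_graph_edge up xy.
by rewrite -rcons_cons !mem_rcons !inE !orbA !orbb.
Qed.

(** The consecutive pairs of the path are an initial segment of those of the cycle. *)
Lemma sub_path_cycle (u : T) p s :
  sub_graph (path_graph (u :: p)) (cycle_graph (u :: p ++ s)).
Proof.
rewrite cycle_graphE; split=> /= [x|x y]; first by rewrite !inE mem_cat orbA => ->.
have sub z : z \in zip (u :: p) p -> z \in zip (u :: p ++ s) (rcons (p ++ s) u).
  rewrite zip_cons_belast => zP.
  by rewrite rcons_cat -cat_cons lastI cat_rcons zip_cat ?size_belast // mem_cat zP.
by rewrite /pair_rel => /orP[] /sub -> //; rewrite orbT.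
Qed.

(* Distinct tails without edges between them are disjoint: a shared vertex would be
   joined to its neighbour in one of the tails. *)
Lemma glue_cycles n u p (X : 'I_n -> seq T) :
  path e u p -> induced e (path_graph (u :: p)) ->
  (forall i, is_cycle e (u :: p ++ X i)) ->
  (forall i, induced e (cycle_graph (u :: p ++ X i))) ->
  (forall i x, x \in X i -> exists2 y, y \in X i & e x y) ->
  (forall i j x y, i != j -> x \in X i -> y \in X j -> ~~ e x y) ->
  (forall i j, i != j ->
     eq_graph (cap_graph (cycle_graph (u :: p ++ X i)) (cycle_graph (u :: p ++ X j)))
              (path_graph (u :: p))) /\
  induced e (bigcup_graph (fun i => cycle_graph (u :: p ++ X i))).
Proof.
move=> up indP cyc indC nbr cross.
have cycE i : cycle e (u :: p ++ X i) by case: (cyc i) => _ /andP[].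
have vE i x : vert (cycle_graph (u :: p ++ X i)) x = (x \in u :: p) || (x \in X i).
  by rewrite /= -cat_cons mem_cat.
split=> [i j ij|x y].
  have vcap x : vert (cycle_graph (u :: p ++ X i)) x ->
      vert (cycle_graph (u :: p ++ X j)) x -> x \in u :: p.
    rewrite !vE => /orP[//|xi] /orP[//|xj].
    by have [y yi xy] := nbr i x xi; case/negP: (cross _ _ _ _ ij yi xj); rewrite eC.
  split=> [x|x y].
    apply/andP/idP=> [[xi xj]|xP]; first exact: vcap.
    by rewrite !vE; split; apply/orP; left.
  apply/andP/idP=> [[]|xy].
    (* An edge of both cycles has its ends on the path, and the path is induced. *)
    case/cycle_graph_edge=> // xi yi xy /cycle_graph_edge[] // xj yj _.
    by apply: indP => //; apply: vcap.
  by split; apply: (sub_path_cycle _ _ _).2.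
move=> /existsP[i xi] /existsP[j yj] xy.
(* By [cross], no edge joins two different tails, so both ends lie in a single cycle, which is
   induced. *)
suff [k [xk yk]] : exists k, vert (cycle_graph (u :: p ++ X k)) x /\
    vert (cycle_graph (u :: p ++ X k)) y.
  by apply/existsP; exists k; apply: indC.
move: yj; have [<-|ij] := eqVneq i j => yj; first by exists i.
move: xi yj; rewrite !vE => /orP[xP yj|xi /orP[yP|yj]].
- by exists j; rewrite !vE xP yj.
- by exists i; rewrite !vE xi yP orbT.
- by case/negP: (cross _ _ _ _ ij xi yj).
Qed.

End Glue.

(* Hexagons u, v, M x, b x, a x, L x. *)
Definition hexagon_family (T : eqType) (e : rel T) (I : finType) (u v : T) : Prop :=
  exists L a b M : I -> T,
    [/\ [/\ injective L, forall x, L x != v &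
            forall l, e u l -> l != v -> exists x, l = L x],
        [/\ injective M, forall x, M x != u &
            forall m, e v m -> m != u -> exists x, m = M x],
        forall x, [/\ e u (L x), e (L x) (a x), e (a x) (b x), e (b x) (M x) & e v (M x)],
        forall x, a x != u /\ b x != v &
        2 < #|I| -> forall x y, x != y -> ~~ e (a x) (b y)].

(** Reading each hexagon backwards exchanges [L] with [M] and [a] with [b]. *)
Lemma hexagon_family_sym (T : eqType) (e : rel T) (I : finType) u v :
  symmetric e -> hexagon_family e I v u -> hexagon_family e I u v.
Proof.
move=> eC [L [a [b [M [HL HM E ab nab]]]]].
exists M, b, a, L; split=> //.
- by move=> x; case: (E x) => *; split; rewrite // eC.
- by move=> x; case: (ab x).
- by move=> I2 x y xy; rewrite eC; apply: nab; rewrite // eq_sym.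
Qed.

(** * Incidence graphs of abstract projective planes; [kd] tells points from lines *)

Section Plane.
Variables (T : eqType) (e : rel T) (kd : T -> bool).
Hypothesis eC : symmetric e.
Hypothesis kd_edge : forall x y, e x y -> kd y = ~~ kd x.
(** The case [x = y] is included and provides a neighbour of every vertex. *)
Hypothesis common_nbr : forall x y, kd x = kd y -> exists2 z, e x z & e y z.
Hypothesis nbr_uniq :
  forall x y z w, e x z -> e x w -> e y z -> e y w -> x != y -> z = w.

Lemma edge_irr : irreflexive e.
Proof. by move=> x; apply/negP=> /kd_edge; case: (kd x). Qed.

Lemma kd_neq x y : kd x = ~~ kd y -> x != y.
Proof. by move=> xy; apply/eqP=> E; move: xy; rewrite E; case: (kd y). Qed.

Lemma kd_path x p : path e x p -> kd (last x p) = kd x (+) odd (size p).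
Proof.
elim: p x => [|y p IHp] x /=; first by rewrite addbF.
by case/andP=> xy /IHp ->; rewrite (kd_edge xy) addNb addbN.
Qed.

Lemma cycle_even c : cycle e c -> ~~ odd (size c).
Proof.
case: c => [//|x p] /= /kd_path; rewrite last_rcons size_rcons /=.
by case: (kd x) (odd _) => [] [].
Qed.

(** Distinctness is only asked of vertices two steps apart, since the other pairs differ in kind.
    There are no chords: a long diagonal would close a 4-cycle, against [nbr_uniq], and vertices two
    steps apart have the same kind. *)
Lemma hexagon x0 x1 x2 x3 x4 x5 :
    e x0 x1 -> e x1 x2 -> e x2 x3 -> e x3 x4 -> e x4 x5 -> e x5 x0 ->
    x0 != x2 -> x2 != x4 -> x4 != x0 -> x1 != x3 -> x3 != x5 -> x5 != x1 ->
  is_cycle e [:: x0; x1; x2; x3; x4; x5] /\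
  induced e (cycle_graph [:: x0; x1; x2; x3; x4; x5]).
Proof.
move=> e01 e12 e23 e34 e45 e50 n02 n24 n40 n13 n35 n51.
have k1 := kd_edge e01; have k2 := kd_edge e12; have k3 := kd_edge e23.
have k4 := kd_edge e34; have k5 := kd_edge e45.
rewrite k1 negbK in k2; rewrite k2 in k3; rewrite k3 negbK in k4; rewrite k4 in k5.
have anti a b c d : e a b -> e b c -> e c d -> a != c -> b != d -> ~~ e a d.
  move=> ab bc cd ac bd; apply/negP=> ad; case/eqP: bd.
  by apply: (nbr_uniq ab ad _ cd ac); rewrite eC.
split.
  split=> //; apply/andP; split; first by rewrite /= e01 e12 e23 e34 e45 e50.
  rewrite /= !inE !negb_or n02 n24 n13 n35 (eq_sym x0 x4) n40 (eq_sym x1 x5) n51.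
  by rewrite !kd_neq // ?k1 ?k2 ?k3 ?k4 ?k5 ?negbK.
have a03 := anti _ _ _ _ e01 e12 e23 n02 n13.
have a14 := anti _ _ _ _ e12 e23 e34 n13 n24.
have a25 := anti _ _ _ _ e23 e34 e45 n24 n35.
have same a b : kd a = kd b -> ~~ e a b.
  by move=> ab; apply/negP=> /kd_edge; rewrite ab; case: (kd b).
move=> x y; rewrite /= !inE /pair_rel !inE !xpair_eqE.
move=> /or4P[|||/or3P[]] /eqP-> /or4P[|||/or3P[]] /eqP-> exy; rewrite ?eqxx ?orbT //; exfalso.
all: move: exy; apply/negP.
all: try by apply: same; rewrite ?k1 ?k2 ?k3 ?k4 ?k5.
all: by rewrite // eC.
Qed.

(** Cycles have even length, so a shorter one would be a 4-cycle, against [nbr_uniq]. *)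
Lemma girth6 c : is_cycle e c -> 6 <= size c.
Proof.
move=> [c3 /andP[cyc unq]]; rewrite leqNgt; apply/negP => c6.
have ev := cycle_even cyc; move: ev c3 c6 cyc unq.
case: c => [|x [|y [|z [|w [|v [|? ?]]]]]] //= _ _ _.
rewrite !inE !negb_or => /and5P[xy yz zw wx _] /and4P[/and3P[_ xz _] /andP[_ yw] _ _].
by case/eqP: yw; apply: (nbr_uniq xy _ _ zw xz); rewrite eC.
Qed.

(** Vertices of the same kind are joined through a common neighbour. Otherwise a neighbour [z] of
    [x] has the kind of [y], which gives a path of length 3, and parity excludes length 2. *)
Lemma dist_le3 x y : exists2 k, dist_is e x y k & k <= 3.
Proof.
have path_ge1 p : path e x p -> last x p = y -> x != y -> 0 < size p.
  by case: p => //= _ ->; rewrite eqxx.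
have path_ge2 p : path e x p -> last x p = y -> x != y -> ~~ e x y -> 1 < size p.
  move=> xp py xy nxy; have := path_ge1 p xp py xy; case: p xp py => [//|z [|w p]] //=.
  by rewrite andbT => exz zy; rewrite -zy exz in nxy.
have [<-|nxy] := eqVneq x y; first by exists 0 => //; split; first by exists [::].
have [exy|nexy] := boolP (e x y).
  exists 1 => //; split=> [|p xp py]; first by exists [:: y]; rewrite /= exy.
  exact: path_ge1 xp py nxy.
have [kxy|kxy] := eqVneq (kd x) (kd y).
  have [z xz yz] := common_nbr kxy.
  exists 2 => //; split=> [|p xp py]; first by exists [:: z; y]; rewrite /= xz eC yz.
  exact: path_ge2 xp py nxy nexy.
have [z xz _] := common_nbr (erefl (kd x)).
have [w zw yw] : exists2 w, e z w & e y w.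
  by apply: common_nbr; rewrite (kd_edge xz); case: (kd x) (kd y) kxy => [] [].
exists 3 => //; split=> [|p xp py].
  by exists [:: z; w; y]; rewrite /= xz zw eC yw.
have := kd_path xp; rewrite py => kp.
have := path_ge2 p xp py nxy nexy; rewrite leq_eqVlt => /orP[/eqP p2|//].
by move: kxy; rewrite kp -p2 addbF eqxx.
Qed.

(** The distance is odd by parity, at most 3, and not 1. *)
Lemma dist3 x y : kd x != kd y -> ~~ e x y -> dist_is e x y 3.
Proof.
move=> kxy nexy; have [k [[p [xp py pk]] le_k] k3] := dist_le3 x y.
suff <- : k = 3 by split=> //; exists p.
have : odd k.
  have := kd_path xp; rewrite py pk => kp.
  by move: kxy; rewrite kp; case: (kd x) (odd k) => [] [].
case: k k3 {le_k} pk => [|[|[|[|k]]]] // _; case: p xp py => [//|z [|//]] /=.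
by rewrite andbT => exz zy; rewrite -zy exz in nexy.
Qed.

(** * Branching, girth and diameter from hexagon families *)

Variables (I : finType).

Hypothesis hexagons : forall u v, e u v -> hexagon_family e I u v.

Lemma valence v : (exists u, e v u) -> valence_ge e v #|I|.+1.
Proof.
case=> u vu; have [L [a [b [M [[L_inj Lu _] _ LE _ _]]]]] := hexagons vu.
exists (u :: [seq L x | x <- enum I]); split.
- rewrite /= map_inj_uniq ?enum_uniq // andbT.
  by apply/mapP=> -[x _ uE]; case/eqP: (Lu x).
- by rewrite /= vu; apply/allP=> _ /mapP[x _ ->]; case: (LE x).
- by rewrite /= size_map -cardE.
Qed.

Lemma has_nbr x : exists y, e x y.
Proof. by have [y xy _] := common_nbr (erefl (kd x)); exists y. Qed.

Lemma other_nbrs n v w : n <= #|I| -> exists vs : 'I_n -> T,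
  injective vs /\ forall i, e v (vs i) /\ vs i != w.
Proof.
move=> nI; have [s [s_uniq /allP sv sI]] := valence (has_nbr v).
(* There are at least [#|I| + 1] neighbours, and [w] is at most one of them. *)
have size_s : n <= size (rem w s).
  apply: (leq_trans nI); have [ws|ws] := boolP (w \in s).
    by rewrite size_rem // -ltnS (ltn_predK sI).
  by rewrite rem_id // ltnW.
have mem_s (i : 'I_n) : nth v (rem w s) i \in rem w s.
  by rewrite mem_nth // (leq_trans (ltn_ord i)).
exists (fun i => nth v (rem w s) i); split=> [i j /eqP|i].
  by rewrite nth_uniq ?rem_uniq ?(leq_trans (ltn_ord _)) // => /eqP/val_inj.
by have := mem_s i; rewrite mem_rem_uniq // inE => /andP[-> /sv].
Qed.

(** The [L x] exhaust the neighbours of [u] other than [v], so each [us i] selects the hexagon of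
    some index [f i]. With a single hexagon there is no pair [i != j] to separate, hence the form of
    the condition on [#|I|]. *)
Lemma hexagons_from n u v (us : 'I_n -> T) :
    (1 < n -> 2 < #|I|) -> e u v -> injective us ->
    (forall i, e u (us i) /\ us i != v) ->
  exists vs a b : 'I_n -> T,
    [/\ injective vs,
        forall i, [/\ e (us i) (a i), e (a i) (b i), e (b i) (vs i) & e v (vs i)],
        forall i, [/\ vs i != u, a i != u & b i != v] &
        forall i j, i != j -> ~~ e (a i) (b j)].
Proof.
move=> n1 uv us_inj usE.
have [L [a [b [M [[L_inj Lv L_onto] [M_inj Mu _] LE ab nab]]]]] := hexagons uv.
have [f fE] : exists f : 'I_n -> I, forall i, us i = L (f i).
  apply: (fin_all_exists (P := fun i x => us i = L x)) => i.
  by have [ui vi] := usE i; apply: L_onto.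
have f_inj : injective f by move=> i j fij; apply: us_inj; rewrite !fE fij.
exists (fun i => M (f i)), (fun i => a (f i)), (fun i => b (f i)); split.
- exact: inj_comp.
- by move=> i; rewrite fE; case: (LE (f i)).
- by move=> i; case: (ab (f i)).
move=> i j ij; apply: nab; last by rewrite (inj_eq f_inj).
apply: n1; case: n i j ij {us usE us_inj f fE f_inj} => [|[|n]] //; first by case.
by move=> i j; rewrite !ord1.
Qed.

(** [X i] is the part of the i-th hexagon outside the path; the last three clauses are the input of
    [glue_cycles]. *)
Definition good_tails n u p v (us : 'I_n -> T) := exists (vs : 'I_n -> T) (X : 'I_n -> seq T),
  [/\ injective vs /\ (forall i, e v (vs i) /\ vs i \notin u :: p),
      forall i, us i \in X i /\ vs i \in X i,
      forall i, [/\ is_cycle e (u :: p ++ X i), size (u :: p ++ X i) = 6 &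
                    induced e (cycle_graph (u :: p ++ X i))],
      forall i x, x \in X i -> exists2 y, y \in X i & e x y &
      forall i j x y, i != j -> x \in X i -> y \in X j -> ~~ e x y].

Lemma same_kdN x y : kd x = kd y -> ~~ e x y.
Proof. by move=> xy; apply/negP=> /kd_edge; rewrite xy; case: (kd y). Qed.

(** Kinds leave only the edges between tails that are listed in [cross]. The family excludes those
    from [a i] to [b j]; any other would close a 4-cycle through [u] or [v]. *)
Lemma good_tails_edge n u v (us : 'I_n -> T) :
    (1 < n -> 2 < #|I|) -> e u v -> injective us ->
    (forall i, e u (us i) /\ us i != v) -> good_tails u [:: v] v us.
Proof.
move=> n1 uv us_inj usE.
have [vs [a [b [vs_inj E ne ab]]]] := hexagons_from n1 uv us_inj usE.
exists vs, (fun i => [:: vs i; b i; a i; us i]).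
have kds i : [/\ kd (vs i) = kd u, kd (b i) = ~~ kd u, kd (a i) = kd u & kd (us i) = ~~ kd u].
  have [usa eab bvs vvs] := E i; have [uus _] := usE i.
  have kus := kd_edge uus.
  have ka : kd (a i) = kd u by rewrite (kd_edge usa) kus negbK.
  have kb : kd (b i) = ~~ kd u by rewrite (kd_edge eab) ka.
  by split=> //; rewrite (kd_edge bvs) kb negbK.
have cross i j : i != j ->
    [/\ ~~ e (vs i) (b j), ~~ e (vs i) (us j), ~~ e (a i) (b j) & ~~ e (a i) (us j)].
  move=> ij; have [usai _ bvsi vvsi] := E i; have [usaj _ bvsj vvsj] := E j.
  have [vui aui bvi] := ne i; have [vuj auj bvj] := ne j.
  have [uusi usvi] := usE i; have [uusj usvj] := usE j.
  split; last 2 first.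
  - exact: ab.
  - apply/negP=> aus; case/eqP: ij; apply: us_inj.
    by apply: (nbr_uniq _ aus uusi uusj aui); rewrite eC.
  - apply/negP=> vsb; case/eqP: bvj.
    apply: (nbr_uniq vsb (_ : e (vs i) v) (_ : e (vs j) (b j))); rewrite 1?eC //.
    by apply: contra_neq ij => /vs_inj.
  - apply/negP=> vsus; case/eqP: usvj.
    by apply: (nbr_uniq vsus _ uusj uv vui); rewrite eC.
split.
- split=> // i; have [_ _ _ vvs] := E i; have [vu _ _] := ne i; split=> //.
  by rewrite !inE negb_or vu eq_sym; apply: contraTneq vvs => <-; rewrite edge_irr.
- by move=> i; rewrite !inE !eqxx !orbT.
- move=> i; have [usa eab bvs vvs] := E i; have [vu au bv] := ne i; have [uus usv] := usE i.
  (* If [vs i = a i] or [b i = us i], then [us i] and [v] would be common neighbours of [u] and of a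
     vertex other than [u], forcing [us i = v]. *)
  have vsa : vs i != a i.
    apply: contra_neq usv => vsa; rewrite vsa in vvs.
    by apply: (@nbr_uniq u (a i)); rewrite // 1?eC // eq_sym.
  have bus : b i != us i.
    apply: contra_neq usv => bus; rewrite bus in bvs.
    by apply: (@nbr_uniq u (vs i)); rewrite // 1?eC // eq_sym.
  by have [] := @hexagon u v (vs i) (b i) (a i) (us i); rewrite // 1?eC // eq_sym.
- move=> i x; have [usa eab bvs vvs] := E i.
  rewrite !inE => /or4P[] /eqP->.
  + by exists (b i); rewrite ?inE ?eqxx ?orbT // eC.
  + by exists (vs i); rewrite ?inE ?eqxx ?orbT.
  + by exists (b i); rewrite ?inE ?eqxx ?orbT.
  + by exists (a i); rewrite ?inE ?eqxx ?orbT.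
move=> i j x y ij; have ji : j != i by rewrite eq_sym.
have [ki1 ki2 ki3 ki4] := kds i; have [kj1 kj2 kj3 kj4] := kds j.
have [] := cross i j ij; have [] := cross j i ji => c1 c2 c3 c4 c5 c6 c7 c8.
rewrite !inE => /or4P[] /eqP-> /or4P[] /eqP-> //; rewrite 1?eC //.
all: by apply: same_kdN; rewrite ?ki1 ?ki2 ?ki3 ?ki4 ?kj1 ?kj2 ?kj3 ?kj4.
Qed.

(** The [us i] and [vs i] have one kind and the [c i] the other, so an edge between two tails ends
    in some [c j]. It would close a 4-cycle [u, us i, c j, us j] or [v, vs i, c j, vs j]. *)
Lemma good_tails_path2 n u w v (us : 'I_n -> T) :
    n <= #|I| -> e u w -> e w v -> u != v -> injective us ->
    (forall i, e u (us i) /\ us i != w) -> good_tails u [:: w; v] v us.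
Proof.
move=> nI uw wv uv us_inj usE.
have [vs [vs_inj vsE]] := other_nbrs v w nI.
have kw := kd_edge uw; have kv := kd_edge wv; rewrite kw negbK in kv.
have kus i : kd (us i) = ~~ kd u by have [/kd_edge] := usE i.
have kvs i : kd (vs i) = ~~ kd u by have [/kd_edge] := vsE i; rewrite kv.
have [c cE] : exists c : 'I_n -> T, forall i, e (us i) (c i) && e (vs i) (c i).
  apply: (fin_all_exists (P := fun i x => e (us i) x && e (vs i) x)) => i.
  have [|x ux vx] := @common_nbr (us i) (vs i); first by rewrite kus kvs.
  by exists x; rewrite ux vx.
have kc i : kd (c i) = kd u by have /andP[/kd_edge-> _] := cE i; rewrite kus negbK.
(* In this and the next two claims a coincidence would make [us i] or [vs i] a common neighbour of
   [u] and [v], hence equal to [w]. *)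
have cu i : c i != u.
  have [vvs vsw] := vsE i; have /andP[_ vsc] := cE i.
  apply: contra_neq vsw => cu; rewrite cu eC in vsc.
  by apply: (nbr_uniq vsc uw vvs _ uv); rewrite eC.
have cv i : c i != v.
  have [uus usw] := usE i; have /andP[usc _] := cE i.
  apply: contra_neq usw => cv; rewrite cv eC in usc.
  by apply: (nbr_uniq uus uw usc _ uv); rewrite eC.
have vsu i : vs i != us i.
  have [vvs vsw] := vsE i; have [uus usw] := usE i.
  apply: contra_neq usw => vsus; rewrite vsus in vvs.
  by apply: (nbr_uniq uus uw vvs _ uv); rewrite eC.
have cross i j : i != j -> ~~ e (us i) (c j) /\ ~~ e (vs i) (c j).
  move=> ij; have [vvsi _] := vsE i; have [uusi _] := usE i.
  have [vvsj _] := vsE j; have [uusj _] := usE j; have /andP[usc vsc] := cE j.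
  split; apply/negP; rewrite eC => ce; case/eqP: ij.
    by apply: us_inj; apply: (nbr_uniq ce _ uusi uusj (cu j)); rewrite eC.
  by apply: vs_inj; apply: (nbr_uniq ce _ vvsi vvsj (cv j)); rewrite eC.
exists vs, (fun i => [:: vs i; c i; us i]); split.
- split=> // i; have [vvs vsw] := vsE i; split=> //.
  by rewrite !inE !negb_or vsw !kd_neq ?kvs ?kv.
- by move=> i; rewrite !inE !eqxx !orbT.
- move=> i; have [vvs vsw] := vsE i; have [uus usw] := usE i; have /andP[usc vsc] := cE i.
  by have [] := @hexagon u w v (vs i) (c i) (us i); rewrite // 1?eC // eq_sym.
- move=> i x; have /andP[usc vsc] := cE i.
  rewrite !inE => /or3P[] /eqP->.
  + by exists (c i); rewrite ?inE ?eqxx ?orbT.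
  + by exists (vs i); rewrite ?inE ?eqxx ?orbT // eC.
  + by exists (c i); rewrite ?inE ?eqxx ?orbT.
move=> i j x y ij; have ji : j != i by rewrite eq_sym.
have [] := cross i j ij; have [] := cross j i ji => c1 c2 c3 c4.
rewrite !inE => /or3P[] /eqP-> /or3P[] /eqP-> //; rewrite 1?eC //.
all: by apply: same_kdN; rewrite ?kus ?kvs ?kc.
Qed.

Lemma plane_branching n : finite_simplicial_graph e ->
  0 < n -> n <= #|I| -> (1 < n -> 2 < #|I|) -> branching e n 6.
Proof.
move=> fin n0 nI n1; split=> //.
  move=> x; have [s [s_uniq sx sI]] := valence (has_nbr x).
  by exists s; split=> //; apply: leq_trans sI.
move=> u v p [up pv unq ind] szp us us_inj usE.
suff [vs [X [[vs_inj vsE] usX cyc nbr cross]]] : good_tails u p v us.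
  have [i|i|cap uni] := glue_cycles eC up ind _ _ nbr cross; [by case: (cyc i)..|].
  exists vs, (fun i => u :: p ++ X i); split=> //.
    by move=> i; have [? -> _] := cyc i.
  move=> i; have [usi vsi] := usX i.
  by split; [rewrite -cat_cons mem_cat usi orbT | rewrite -cat_cons mem_cat vsi orbT
            | apply: sub_path_cycle].
case: szp => szp.
  case: p szp up pv {unq ind} usE => [|w [|//]] //= _; rewrite andbT => uw <- usE.
  apply: good_tails_edge => // i; have [uus] := usE i.
  by rewrite !inE negb_or => /andP[].
case: p szp up pv unq {ind} usE => [|w [|w' [|//]]] //= _ /and3P[uw wv _] <-.
rewrite !inE !negb_or => /andP[/andP[_ uv] _] usE.
apply: good_tails_path2 => // i; have [uus] := usE i.
by rewrite !inE !negb_or => /and3P[].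
Qed.

(** One tail, with [n = 1], closes the edge to a hexagon. *)
Lemma plane_girth u v : e u v -> 0 < #|I| -> girth_is e 6.
Proof.
move=> uv I0; split; last exact: girth6.
have [us [us_inj usE]] := other_nbrs u v (n := 1) I0.
have [|vs [X [_ _ cyc _ _]]] := good_tails_edge _ uv us_inj usE; first by [].
by have [] := cyc ord0; exists (u :: [:: v] ++ X ord0).
Qed.

Lemma plane_diameter u v : e u v -> 0 < #|I| -> diameter_is e 3.
Proof.
move=> uv I0; split; first exact: dist_le3.
have [us [us_inj usE]] := other_nbrs u v (n := 1) I0.
have [|vs [a [b [_ E ne _]]]] := hexagons_from _ uv us_inj usE; first by [].
have [usa _ _ _] := E ord0; have [_ au _] := ne ord0; have [uus usv] := usE ord0.
have ka : kd (a ord0) = ~~ kd v.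
  by rewrite (kd_edge usa) (kd_edge uus) (kd_edge uv).
(* These two are opposite vertices of a hexagon. *)
exists (a ord0), v; apply: dist3; first by rewrite ka; case: (kd v).
apply: contraNN usv => av; apply/eqP.
by apply: (nbr_uniq uus uv _ av); rewrite // 1?eC // eq_sym.
Qed.

End Plane.

(** * Preliminaries on dimensions and on functions over a field *)

Lemma dim_add_line (K : fieldType) (vT : vectType K) (U : {vspace vT}) w :
  w \notin U -> \dim (U + <[w]>) = (\dim U).+1.
Proof.
move=> wU; apply/eqP; rewrite eqn_leq; apply/andP; split.
  have [le _] := dimv_add_leqif U <[w]>; apply: leq_trans le _.
  by rewrite dim_vline -addn1 leq_add2l leq_b1.
rewrite ltnNge; apply: contra wU => le.
have /eqP-> : U == (U + <[w]>)%VS by rewrite eqEdim addvSl le.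
by rewrite memvE addvSr.
Qed.

(** Over two elements [s = 1] is the only choice; otherwise a nonzero element remains after 1 is
    removed. *)
Lemma exists_scalar_neq01 (K : finFieldType) :
  exists2 s : K, s != 0%R & 2 < #|K| -> s != 1%R.
Proof.
have [K2|K2] := leqP #|K| 2; first by exists 1%R; first exact: oner_neq0.
have : 0 < #|[set~ (0%R : K)] :\ 1%R|.
  rewrite -(ltn_add2l ((1%R : K) \in [set~ (0%R : K)])) -cardsD1 cardsC1 addn0.
  by case: (_ \in _) #|K| K2 => [] [|[|[|]]].
by case/card_gt0P=> s; rewrite !inE => /andP[s1 s0]; exists s.
Qed.

(* f is the indicator function of 0, whose chords at 0 have nonzero slope and whose chords
   at x <> 0 have slope 0 or [- x^-1], whereas [m 0 = 0] (as [0^-1 = 0]) and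
   [m x = - (s * x^-1)] with s different from 0 and 1. *)
Lemma graph_with_tangents (K : fieldType) (s : K) : s != 0%R ->
  exists f m : K -> K, [/\ injective m, forall t, exists x, t = m x &
    s != 1%R -> forall x y, y != x -> f y != (f x + (y - x) * m x)%R].
Proof.
move=> s0; exists (fun x : K => (x == 0)%:R)%R, (fun x : K => - (s * x^-1))%R.
split=> [x y /oppr_inj/(mulfI s0)/invr_inj //|t|s1 x y yx].
  (* [m] is an involution, also at 0 since [0^-1 = 0], so the preimage of [t] is [m t]. *)
  by exists (- (s / t))%R; rewrite invrN mulrN opprK invf_div mulrC divfK.
have [x0|x0] := eqVneq x 0%R.
  by move: yx; rewrite x0 => /negPf->; rewrite invr0 !mulr0 oppr0 mulr0 addr0 eq_sym oner_eq0.
(* The line of slope [m x] through [(x, 0)] has height [s] at 0, where [f] is 1, and nonzero height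
   at any other [y != x], where [f] is 0. *)
rewrite add0r; have [y0|y0] := eqVneq y 0%R.
  by rewrite y0 add0r mulrNN mulrCA divff // mulr1 eq_sym.
by rewrite eq_sym mulf_neq0 ?subr_eq0 // oppr_eq0 mulf_neq0 // invr_eq0.
Qed.

(** * The Levi graph as an abstract projective plane *)

Section Levi.
Variable F : finFieldType.
Local Notation V := 'rV[F]_3.
Local Notation vertex := (levi_vertex F).

Definition is_point (x : vertex) : bool := \dim (val x) == 1.

Lemma dim_point (x : vertex) : is_point x -> \dim (val x) = 1.
Proof. by move/eqP. Qed.

Lemma dim_line (x : vertex) : ~~ is_point x -> \dim (val x) = 2.
Proof. by rewrite /is_point; case: x => U /= /orP[->|/eqP]. Qed.

Lemma leviC : symmetric (@levi F).
Proof. by move=> x y; rewrite /levi orbC. Qed.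

Lemma levi_is_point x y : levi x y -> is_point y = ~~ is_point x.
Proof. by rewrite /is_point => /orP[] /and3P[/eqP-> /eqP->]. Qed.

Lemma leviE (x y : vertex) :
  is_point x -> ~~ is_point y -> levi x y = (val x <= val y)%VS.
Proof.
move=> px ly; rewrite /levi /incident (dim_point px) (dim_line ly) /= orbF.
by [].
Qed.

Lemma val_eqEdim (x y : vertex) :
  is_point x = is_point y -> (val x <= val y)%VS -> x = y.
Proof.
move=> xy sub; apply/val_inj/eqP; rewrite eqEdim sub /=.
have [px|lx] := boolP (is_point x).
  by rewrite (dim_point px) dim_point // -xy.
by rewrite (dim_line lx) dim_line // -xy.
Qed.

Lemma dim_space : dim V = 3.
Proof. by rewrite dim_matrix. Qed.

Lemma exists_notin (U : {vspace V}) : \dim U < 3 -> exists w, w \notin U.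
Proof.
move=> U3; have /subvPn[w _ wU] : ~~ (fullv <= U)%VS.
  by apply: contraL U3 => /dimvS; rewrite dimvf dim_space -leqNgt.
by exists w.
Qed.

Lemma dim_span_points (x y : vertex) :
  is_point x -> is_point y -> x != y -> \dim (val x + val y) = 2.
Proof.
move=> px py xy; apply/eqP; rewrite eqn_leq; apply/andP; split.
  have [le _] := dimv_add_leqif (val x) (val y); apply: leq_trans le _.
  by rewrite !dim_point.
rewrite ltnNge; apply: contra xy => le.
have /eqP xE : val x == (val x + val y)%VS by rewrite eqEdim addvSl dim_point.
by apply/eqP/esym/val_eqEdim; rewrite ?py // xE addvSr.
Qed.

(** Distinct points span a line, and a single point extends to one. Two lines meet because 2 + 2
    exceeds the dimension 3. *)
Lemma levi_common_nbr (x y : vertex) :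
  is_point x = is_point y -> exists2 z, levi x z & levi y z.
Proof.
have [px /esym py|lx /esym ly] := boolP (is_point x).
  suff [U /eqP dU] : exists2 U, \dim U = 2 & (val x + val y <= U)%VS.
    rewrite subv_add => /andP[xU yU].
    have dU' : (\dim U == 1) || (\dim U == 2) by rewrite dU orbT.
    by exists (exist _ U dU'); rewrite leviE // /is_point /= (eqP dU).
  have [<-|xy] := eqVneq x y.
    have [|w wx] := @exists_notin (val x); first by rewrite dim_point.
    by exists (val x + <[w]>)%VS; rewrite ?dim_add_line ?dim_point // addvv addvSl.
  by exists (val x + val y)%VS => //; apply: dim_span_points.
have cap_gt0 : 0 < \dim (val x :&: val y).
  rewrite lt0n; apply/eqP=> cap0; have := dimv_sum_cap (val x) (val y).
  rewrite cap0 !dim_line ?ly // addn0 => sum4.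
  by have := dimvS (subvf (val x + val y)); rewrite dimvf dim_space sum4.
set w := vpick (val x :&: val y).
have w0 : w != 0%R by rewrite vpick0 -dimv_eq0 -lt0n.
have : w \in (val x :&: val y)%VS := memv_pick _.
rewrite memv_cap => /andP[wx wy].
have dw : (\dim <[w]> == 1) || (\dim <[w]> == 2) by rewrite dim_vline w0.
pose z : vertex := exist _ <[w]>%VS dw.
have pz : is_point z by rewrite /is_point /z SubK dim_vline w0.
by exists z; rewrite leviC leviE ?ly // /z SubK -memvE.
Qed.

(** A line through two distinct points is their sum. The dual case is the contrapositive: if [z] and
    [w] are distinct points, then the lines [x] and [y] through them coincide. *)
Lemma levi_nbr_uniq (x y z w : vertex) :
  levi x z -> levi x w -> levi y z -> levi y w -> x != y -> z = w.
Proof.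
have join (x' y' z' w' : vertex) : is_point x' ->
    levi x' z' -> levi x' w' -> levi y' z' -> levi y' w' -> x' != y' -> z' = w'.
  move=> px xz xw yz yw xy.
  have lz : ~~ is_point z' by rewrite (levi_is_point xz) px.
  have lw : ~~ is_point w' by rewrite (levi_is_point xw) px.
  have py : is_point y'.
    by have := levi_is_point yz; rewrite (negPf lz) => /esym/negbFE.
  have span (t : vertex) : ~~ is_point t -> levi x' t -> levi y' t ->
      val t = (val x' + val y')%VS.
    move=> lt; rewrite !leviE // => xt yt; apply/esym/eqP.
    by rewrite eqEdim subv_add xt yt dim_span_points // dim_line.
  by apply: val_inj; rewrite (span z') // (span w').
have [px|lx] := boolP (is_point x); first exact: join px.
move=> xz xw yz yw; apply: contra_neq_eq => zw.
have pz : is_point z by rewrite (levi_is_point xz).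
by apply: (join z w) => //; rewrite leviC.
Qed.

(** Each vertex is the span of a pair of vectors, the same one twice for a point; [insub] discards
    the spans that are not vertices. *)
Lemma levi_finite : finite_simplicial_graph (@levi F).
Proof.
split; [|exact: leviC|exact: edge_irr levi_is_point].
exists (pmap insub [seq (<[p.1]> + <[p.2]>)%VS | p : V * V]) => x.
rewrite mem_pmap_sub; apply/mapP.
have x0 (w : V) : w \in val x -> (<[w]> <= val x)%VS by rewrite memvE.
have vp := memv_pick (val x).
have v0 : vpick (val x) != 0%R.
  by rewrite vpick0 -dimv_eq0; case: (x) => U /= /orP[] /eqP->.
have [px|lx] := boolP (is_point x).
  exists (vpick (val x), vpick (val x)); first by rewrite mem_enum.
  apply/esym/eqP; rewrite /= addvv eqEdim x0 //.
  by rewrite dim_vline v0 dim_point.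
have /subvPn[w wx wv] : ~~ (val x <= <[vpick (val x)]>)%VS.
  by apply/negP=> /dimvS; rewrite dim_vline v0 dim_line.
exists (vpick (val x), w); first by rewrite mem_enum.
apply/esym/eqP; rewrite /= eqEdim subv_add !x0 //.
by rewrite dim_add_line // dim_vline v0 dim_line.
Qed.

(** * Homogeneous coordinates adapted to a flag *)

Section Frame.
Local Open Scope ring_scope.
Variables (u v : vertex) (e1 e2 e3 : V).
Hypothesis pu : is_point u.
Hypothesis lv : ~~ is_point v.
Hypothesis uE : val u = <[e1]>%VS.
Hypothesis vE : val v = (<[e1]> + <[e2]>)%VS.
Hypothesis e3v : e3 \notin val v.

(** The ordinate comes first: [vec y x 1] is the affine point of abscissa [x] and ordinate [y],
    [vec m 1 0] the point at infinity of slope [m], and [vec 1 0 0] the vertical direction [u]. *)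
Definition vec a b c : V := a *: e1 + b *: e2 + c *: e3.

(** The coefficients vanish from last to first: [e3] lies outside [v], [e2] lies outside [u] as [v]
    is a plane, and [e1] is nonzero. *)
Lemma vec_eq0 a b c : vec a b c = 0 -> [/\ a = 0, b = 0 & c = 0].
Proof.
rewrite /vec => abc; have e1u : e1 \in val u by rewrite uE memv_line.
have in_v a' b' : a' *: e1 + b' *: e2 \in val v.
  by rewrite vE memv_add // memvZ // memv_line.
have c0 : c = 0.
  apply: contraNeq e3v => c0; rewrite -[e3]scale1r -(mulVf c0) -scalerA memvZ //.
  by rewrite -(addKr (a *: e1 + b *: e2) (c *: e3)) abc addr0 rpredN.
have e2u : e2 \notin val u.
  apply/negP=> e2u; have : (val v <= val u)%VS by rewrite vE subv_add -uE subvv -memvE.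
  by move/dimvS; rewrite (dim_point pu) (dim_line lv).
have b0 : b = 0.
  apply: contraNeq e2u => b0; rewrite -[e2]scale1r -(mulVf b0) -scalerA memvZ //.
  have := addKr (a *: e1) (b *: e2).
  by move: abc; rewrite c0 scale0r addr0 => -> <-; rewrite addr0 rpredN memvZ.
have a0 : a = 0.
  move/eqP: abc; rewrite c0 b0 !scale0r !addr0 scaler_eq0 => /orP[/eqP//|/eqP e10].
  by have := dim_point pu; rewrite uE e10 dim_vline eqxx.
by [].
Qed.

Lemma vecB a b c a' b' c' : vec a b c - vec a' b' c' = vec (a - a') (b - b') (c - c').
Proof. by rewrite /vec !scalerBl !opprD addrACA (addrACA (a *: e1)). Qed.

Lemma vecD a b c a' b' c' : vec a b c + vec a' b' c' = vec (a + a') (b + b') (c + c').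
Proof. by rewrite /vec !scalerDl addrACA (addrACA (a *: e1)). Qed.

Lemma vecZ t a b c : t *: vec a b c = vec (t * a) (t * b) (t * c).
Proof. by rewrite /vec !scalerDr !scalerA. Qed.

Lemma vec_inj a b c a' b' c' :
  vec a b c = vec a' b' c' -> [/\ a = a', b = b' & c = c'].
Proof.
by move/eqP; rewrite -subr_eq0 vecB => /eqP/vec_eq0[] /subr0_eq-> /subr0_eq-> /subr0_eq->.
Qed.

Lemma vec_onto w : exists a b c, w = vec a b c.
Proof.
have : w \in (val v + <[e3]>)%VS.
  have /eqP-> : (val v + <[e3]>)%VS == fullv.
    by rewrite eqEdim subvf dimvf dim_space dim_add_line // dim_line.
  exact: memvf.
rewrite vE => /memv_addP[_ /memv_addP[_ /vlineP[a ->] [_ /vlineP[b ->] ->]] [_ /vlineP[c ->] ->]].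
by exists a, b, c.
Qed.

Lemma mem_line_vec w a b c : w \in (<[vec a b c]>)%VS -> exists t, w = vec (t * a) (t * b) (t * c).
Proof. by case/vlineP=> t ->; exists t; rewrite vecZ. Qed.

Lemma mem_plane_vec w a b c a' b' c' :
  w \in (<[vec a b c]> + <[vec a' b' c']>)%VS ->
  exists s t, w = vec (s * a + t * a') (s * b + t * b') (s * c + t * c').
Proof.
case/memv_addP=> _ /mem_line_vec[s ->] [_ /mem_line_vec[t ->] ->].
by exists s, t; rewrite vecD.
Qed.

Lemma uvec : val u = <[vec 1 0 0]>%VS.
Proof. by rewrite uE /vec scale1r !scale0r !addr0. Qed.

Lemma vvec : val v = (<[vec 1 0 0]> + <[vec 0 1 0]>)%VS.
Proof. by rewrite -uvec vE uE /vec scale1r !scale0r addr0 add0r. Qed.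

Lemma point_vec a b c : vec a b c <> 0 -> exists x : vertex, is_point x /\ val x = <[vec a b c]>%VS.
Proof.
move=> /eqP w0; have dw : (\dim <[vec a b c]> == 1)%N || (\dim <[vec a b c]> == 2)%N.
  by rewrite dim_vline w0.
by exists (exist _ <[vec a b c]>%VS dw); rewrite /is_point SubK dim_vline w0.
Qed.

Lemma line_vec a b c a' b' c' :
  vec a b c <> 0 -> vec a' b' c' \notin <[vec a b c]>%VS ->
  exists x : vertex, ~~ is_point x /\ val x = (<[vec a b c]> + <[vec a' b' c']>)%VS.
Proof.
move=> /eqP w0 ww'; have dw : \dim (<[vec a b c]> + <[vec a' b' c']>) = 2.
  by rewrite dim_add_line // dim_vline w0.
have dx : (\dim (<[vec a b c]> + <[vec a' b' c']>) == 1)%N ||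
          (\dim (<[vec a b c]> + <[vec a' b' c']>) == 2)%N by rewrite dw.
exists (exist _ (<[vec a b c]> + <[vec a' b' c']>)%VS dx).
  by rewrite /is_point SubK dw.
Qed.

(* In the affine plane with line at infinity v, whose vertical lines are those through u,
   b x is the line of slope [m x] through the point a x of the graph of f. *)
Lemma frame_hexagons : hexagon_family (@levi F) F u v.
Proof.
have [s s0 s1] := exists_scalar_neq01 F.
have [f [m [m_inj m_onto fm]]] := graph_with_tangents s0.
have n0 a b c : [|| a != 0, b != 0 | c != 0] -> vec a b c <> 0.
  by move=> abc /vec_eq0[a0 b0 c0]; rewrite a0 b0 c0 !eqxx in abc.
have [L LE] : exists L : F -> vertex, forall x, ~~ is_point (L x) /\
    val (L x) = (<[vec 1%R 0%R 0%R]> + <[vec 0%R x 1%R]>)%VS.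
  apply: (fin_all_exists (P := fun x y => ~~ is_point y /\ val y = _)) => x.
  apply: line_vec; first by apply: n0; rewrite oner_eq0.
  by apply/negP=> /mem_line_vec[t] /vec_inj[_ _ /eqP]; rewrite mulr0 oner_eq0.
have [a aE] : exists a : F -> vertex, forall x, is_point (a x) /\
    val (a x) = <[vec (f x) x 1%R]>%VS.
  apply: (fin_all_exists (P := fun x y => is_point y /\ val y = _)) => x.
  by apply: point_vec; apply: n0; rewrite oner_eq0 !orbT.
have [M ME] : exists M : F -> vertex, forall x, is_point (M x) /\
    val (M x) = <[vec (m x) 1%R 0%R]>%VS.
  apply: (fin_all_exists (P := fun x y => is_point y /\ val y = _)) => x.
  by apply: point_vec; apply: n0; rewrite oner_eq0 !orbT.
have [b bE] : exists b : F -> vertex, forall x, ~~ is_point (b x) /\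
    val (b x) = (<[vec (f x) x 1%R]> + <[vec (m x) 1%R 0%R]>)%VS.
  apply: (fin_all_exists (P := fun x y => ~~ is_point y /\ val y = _)) => x.
  apply: line_vec; first by apply: n0; rewrite oner_eq0 !orbT.
  apply/negP=> /mem_line_vec[t] /vec_inj[_ /eqP + /esym/eqP]; rewrite mulr1 => + /eqP t0.
  by rewrite t0 mul0r oner_eq0.
have L_sub x (l : vertex) : ~~ is_point l -> (val u <= val l)%VS ->
    vec 0 x 1 \in val l -> l = L x.
  move=> ll ul wl; have [lL LxE] := LE x; apply/esym/val_eqEdim.
    by rewrite (negPf ll) (negPf lL).
  by rewrite LxE subv_add -uvec ul -memvE.
have M_sub x (p : vertex) : is_point p -> vec (m x) 1 0 \in val p -> p = M x.
  move=> pp wp; have [pM MxE] := ME x; apply/esym/val_eqEdim; first by rewrite pp pM.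
  by rewrite MxE -memvE.
exists L, a, b, M; split.
- split=> [x y xy|x|l ul lv'].
  + have : vec 0 y 1 \in val (L x) by rewrite xy (LE y).2 (subvP (addvSr _ _)) ?memv_line.
    rewrite (LE x).2 => /mem_plane_vec[r [t /vec_inj[_]]].
    by rewrite !mulr0 !add0r mulr1 => -> <-; rewrite mul1r.
  + apply: contraNneq e3v => Lv.
    have : vec 0 x 1 \in val v by rewrite -Lv (LE x).2 (subvP (addvSr _ _)) ?memv_line.
    rewrite vvec => /mem_plane_vec[r [t /vec_inj[_ _ /eqP]]].
    by rewrite !mulr0 addr0 oner_eq0.
  have ll : ~~ is_point l by rewrite (levi_is_point ul) pu.
  rewrite leviE // in ul.
  have /subvPn[w wl wv] : ~~ (val l <= val v)%VS.
    apply: contraNN lv' => lv'; apply/eqP/val_eqEdim => //.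
    by rewrite (negPf ll) (negPf lv).
  have [r [t [c wE]]] := vec_onto w.
  have c0 : c != 0.
    apply: contraNneq wv => c0; rewrite wE c0 /vec scale0r addr0 vE.
    by rewrite memv_add // memvZ // memv_line.
  (* Subtracting a vector of [u] from [w] and dividing by [c] leaves the affine point of [l] with
     ordinate 0, of abscissa [t / c]. *)
  exists (t / c); apply: L_sub => //.
  have -> : vec 0 (t / c) 1 = c^-1 *: (w - r *: vec 1 0 0).
    rewrite wE vecZ vecB vecZ !mulr0 mulr1 subrr mulr0 !subr0 mulVf //.
    by rewrite [t / c]mulrC.
  by rewrite memvZ // memvB // memvZ // (subvP ul) // uvec memv_line.
- split=> [x y xy|x|p vp pu'].
  + have : vec (m y) 1 0 \in val (M x) by rewrite xy (ME y).2 memv_line.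
    rewrite (ME x).2 => /mem_line_vec[t /vec_inj[mE t1 _]].
    by move: mE; rewrite mulr1 in t1; rewrite -t1 mul1r => /m_inj.
  + apply/eqP=> Mu; have : vec (m x) 1 0 \in val u by rewrite -Mu (ME x).2 memv_line.
    by rewrite uvec => /mem_line_vec[t /vec_inj[_ /eqP + _]]; rewrite mulr0 oner_eq0.
  have pp : is_point p by rewrite (levi_is_point vp).
  rewrite leviC leviE // in vp.
  have /subvPn[w wp wu] : ~~ (val p <= val u)%VS.
    by apply: contraNN pu' => pu'; apply/eqP/val_eqEdim => //; rewrite pp pu.
  have : w \in val v := subvP vp _ wp.
  rewrite vvec => /mem_plane_vec[r [t]]; rewrite !mulr0 !mulr1 !addr0 add0r => wE.
  have t0 : t != 0.
    apply: contraNneq wu => t0; rewrite wE t0 /vec !scale0r !addr0 uE.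
    by rewrite memvZ // memv_line.
  (* Dividing [w] by [t] shows that [p] is the point at infinity of slope [t^-1 * r]. *)
  have [x xE] := m_onto (t^-1 * r); exists x; apply: M_sub => //.
  have -> : vec (m x) 1 0 = t^-1 *: w by rewrite wE vecZ -xE mulr0 mulVf.
  exact: memvZ.
- move=> x; have [lL LxE] := LE x; have [pa axE] := aE x.
  have [lb bxE] := bE x; have [pM MxE] := ME x; split.
  + by rewrite leviE // LxE uvec addvSl.
  + rewrite leviC leviE // LxE axE -memvE.
    have -> : vec (f x) x 1 = f x *: vec 1 0 0 + vec 0 x 1.
      by rewrite vecZ vecD mulr1 !mulr0 !add0r addr0.
    by rewrite memv_add ?memvZ ?memv_line.
  + by rewrite leviE // axE bxE addvSl.
  + by rewrite leviC leviE // MxE bxE addvSr.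
  rewrite leviC leviE // MxE vvec -memvE.
  have -> : vec (m x) 1 0 = m x *: vec 1 0 0 + vec 0 1 0.
    by rewrite vecZ vecD mulr1 !mulr0 !add0r !addr0.
  by rewrite memv_add ?memvZ ?memv_line.
- move=> x; have [lb bxE] := bE x; have [pa axE] := aE x; split; apply/eqP=> E.
    have : vec (f x) x 1 \in val u by rewrite -E axE memv_line.
    by rewrite uvec => /mem_line_vec[t /vec_inj[_ _ /eqP]]; rewrite mulr0 oner_eq0.
  have : vec (f x) x 1 \in val v by rewrite -E bxE (subvP (addvSl _ _)) ?memv_line.
  rewrite vvec => /mem_plane_vec[r [t /vec_inj[_ _ /eqP]]].
  by rewrite !mulr0 addr0 oner_eq0.
move=> F2 y x yx; have [lb bxE] := bE x; have [pa ayE] := aE y.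
(* If [a y] lies on [b x], the third coordinate gives [r = 1] and the second [t = y - x]; the first
   then contradicts [fm]. *)
rewrite leviE // ayE bxE -memvE; apply/negP=> /mem_plane_vec[r [t /vec_inj[]]].
rewrite !mulr1 mulr0 addr0 => + + r1; rewrite -{}r1 !mul1r => /eqP fE.
move/esym/(canRL (addKr _)) => tE; move: fE; rewrite {}tE addrC.
by apply/negP; rewrite addrC [- x + y]addrC; apply: fm; rewrite ?s1.
Qed.

End Frame.

(** A flag with [u] a point has an adapted basis: [e1] spans [u], [e2] completes it to [v], and [e3]
    lies outside [v]. If [u] is a line, the family of the reversed flag is turned around. *)
Lemma levi_hexagons u v : levi u v -> hexagon_family (@levi F) F u v.
Proof.
have flag (u' v' : vertex) : is_point u' -> levi u' v' -> hexagon_family (@levi F) F u' v'.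
  move=> pu uv; have lv : ~~ is_point v' by rewrite (levi_is_point uv) pu.
  rewrite leviE // in uv.
  have e10 : vpick (val u') != 0%R by rewrite vpick0 -dimv_eq0 dim_point.
  have uE : val u' = <[vpick (val u')]>%VS.
    by apply/esym/eqP; rewrite eqEdim -memvE memv_pick dim_vline e10 dim_point.
  have /subvPn[e2 e2v e2u] : ~~ (val v' <= val u')%VS.
    by apply/negP=> /dimvS; rewrite (dim_line lv) (dim_point pu).
  have vE : val v' = (<[vpick (val u')]> + <[e2]>)%VS.
    apply/esym/eqP; rewrite -uE eqEdim subv_add uv -memvE e2v.
    by rewrite dim_add_line // (dim_point pu) (dim_line lv).
  have [|e3 e3v] := @exists_notin (val v'); first by rewrite dim_line.
  exact: frame_hexagons pu lv uE vE e3v.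
have [pu|lu] := boolP (is_point u); first exact: flag.
move=> uv; apply: hexagon_family_sym; first exact: leviC.
by apply: flag; rewrite 1?leviC // (levi_is_point uv) lu.
Qed.

Lemma exists_flag : exists u v : vertex, levi u v.
Proof.
have [|w w0] := @exists_notin (0%VS : {vspace V}); first by rewrite dimv0.
have dw : (\dim <[w]> == 1) || (\dim <[w]> == 2) by rewrite dim_vline -memv0 w0.
have [v uv _] := @levi_common_nbr (exist _ <[w]>%VS dw) _ erefl.
by exists (exist _ <[w]>%VS dw), v.
Qed.

End Levi.

Theorem proposition6p7 (q p k : nat) (p_prime : prime p) (k_gt0 : 0 < k)
    (q_def : q = p ^ k) (F : finFieldType) (card_F : #|F| = q) :
  [/\ finite_simplicial_graph (@levi F),
      diameter_is (@levi F) 3,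
      girth_is (@levi F) 6 &
      (q = 2 -> branching (@levi F) 1 6) /\
      (q <> 2 -> branching (@levi F) q 6)].
Proof.
have q_gt1 : 1 < q by rewrite q_def -(exp1n k) ltn_exp2r // prime_gt1.
have [u [v uv]] := exists_flag F.
have branch := plane_branching (@leviC F) (@levi_is_point F) (@levi_common_nbr F)
  (@levi_nbr_uniq F) (@levi_hexagons F) (levi_finite F).
have F_gt0 : 0 < #|F| by rewrite card_F ltnW.
split.
- exact: levi_finite.
- exact: (plane_diameter (@leviC F) (@levi_is_point F) (@levi_common_nbr F)
    (@levi_nbr_uniq F) (@levi_hexagons F) uv F_gt0).
- exact: (plane_girth (@leviC F) (@levi_is_point F) (@levi_common_nbr F)
    (@levi_nbr_uniq F) (@levi_hexagons F) uv F_gt0).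
(* The condition [1 < n -> 2 < #|F|] is vacuous for [n = 1]; for [n = q] it holds because [q]
   exceeds 1 and is not 2. *)
split=> [_|q2]; first by apply: branch.
apply: branch; rewrite ?card_F ?(ltnW q_gt1) // => _.
by rewrite ltn_neqAle eq_sym; apply/andP; split=> //; apply/eqP.
Qed.
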